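(* Let $N > 2$ be an integer. The following statements are equivalent: (i) $N$ is prime; (ii) for all $(i,j) \in \mathcal{D}_{j \leq i}$: $\mathbf{1}_{\mathbb{Z}\setminus N\mathbb{Z}}(S^N_{i,j}) = \frac{1+(-1)^{i+j}}{2}$; (iii) for all $(i,j) \in \mathcal{D}_{j \leq i}$: $\mathbf{1}_{\mathbb{Z}\setminus N\mathbb{Z}}(W^N_{i,j}) = \frac{1-(-1)^{i+j}}{2}$; (iv) for all $(i,j) \in \mathcal{D}_{j \leq i}$: $\left|\mathbf{1}_{\mathbb{Z}\setminus N\mathbb{Z}}(S^N_{i,j})-\mathbf{1}_{\mathbb{Z}\setminus N\mathbb{Z}}(W^N_{i,j})\right| = 1$.
   Context: $\mathcal{D}_{j\le i}$ is the set of integer pairs $(i,j)$ with $0 \le j \le i \le N-1$. For $(i,j)\in\mathcal{D}_{j\le i}$, $S^N_{i,j} = \binom{i}{j} + \binom{N-1-j}{N-1-i}$ and $W^N_{i,j} = \binom{i}{j} - \binom{N-1-j}{N-1-i}$. For an integer $x$, $\mathbf{1}_{\mathbb{Z}\setminus N\mathbb{Z}}(x)$ equals $0$ if $N$ divides $x$, and $1$ otherwise. *)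

(* Defs.v *)
From mathcomp Require Import all_boot all_order all_algebra.
Set Implicit Arguments.
Unset Strict Implicit.
Unset Printing Implicit Defensive.
Import Order.TTheory GRing.Theory Num.Theory.
Local Open Scope ring_scope.

(* On Dle N the natural-number subtractions in Sbin and Wbin do not
   truncate, provided 0 < N. *)
Definition Dle (N i j : nat) : bool := (j <= i <= N - 1)%N.

Definition Sbin (N i j : nat) : int :=
  'C(i, j)%:Z + 'C(N - 1 - j, N - 1 - i)%:Z.

Definition Wbin (N i j : nat) : int :=
  'C(i, j)%:Z - 'C(N - 1 - j, N - 1 - i)%:Z.

(* Rational-valued, because it is compared with (1 +/- (-1)^(i+j)) / 2. *)
Definition ind_nondvd (N : nat) (x : int) : rat :=
  if (N%:Z %| x)%Z then 0 else 1.

(* Main.v *)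
Require Import Defs.
From mathcomp Require Import all_boot all_order all_algebra.
From mathcomp Require Import ring zify.
Set Implicit Arguments.
Unset Strict Implicit.
Unset Printing Implicit Defensive.
Import Order.TTheory GRing.Theory Num.Theory.
Local Open Scope ring_scope.

(** Write T(i, j) for the reflected binomial 'C(N-1-j, N-1-i), so that
    S = 'C(i, j) + T and W = 'C(i, j) - T.  Everything is computed modulo N, and
    rests on Pascal's rule 'C(N, k) = 'C(N-1, k) + 'C(N-1, k-1) together with
    the fact that N divides 'C(N, k) when k > 0 is coprime to N.

    Let p be the least prime factor of N and m = N / p.  All k with 0 < k < p
    are coprime to N, so Pascal's rule makes 'C(N-1, k) alternate:
    'C(N-1, k) = (-1)^k modulo N for k < p ([bin_pred_natr]).  At k = p the
    alternation breaks, since 'C(N, p) = m * 'C(N-1, p-1), and one gets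
    'C(N-1, p) = (-1)^p (1 - m) ([bin_pred_pdiv_natr]).

    If N is prime, then p = N and the alternation propagates from column 0 to
    all columns: T(i, j) = (-1)^(i+j) 'C(i, j) modulo N ([bin_reflect_natr]).
    Hence S is 2 'C(i, j) or 0 and W is 0 or 2 'C(i, j), according to the parity
    of i + j; as N > 2 is prime and i < N, it does not divide 2 'C(i, j).  This
    gives (ii), (iii) and (iv).

    If N is composite, then 1 < p <= m < N, and the defect m at row p of
    column 0 refutes each of the three patterns.  For p odd,
    S(p, 0) = m, W(p, 0) = 2 - m and, as p + 1 is coprime to N,
    W(p + 1, 0) = m; for p = 2, S(2, 0) = 2 - m and W(2, 0) = m.  None of these
    is 0 modulo N unless m = 2, that is N = 4.  The two cases left over
    are S for N even, where S(N - 1, 0) = 2 is at an odd row, and N = 4, where N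
    divides both S(2, 1) and W(2, 1). *)

(** * Entries of row N of Pascal's triangle divisible by N *)

(** Cancel k in k * 'C(N, k) = N * 'C(N-1, k-1). *)
Lemma coprime_dvdn_bin (N k : nat) :
  (0 < k)%N -> coprime N k -> (N %| 'C(N, k))%N.
Proof.
case: k => // k _ coNk.
by rewrite -(Gauss_dvdr _ coNk) -mul_bin_diag dvdn_mulr.
Qed.

Lemma coprime_lt_pdiv (N k : nat) : (0 < k < pdiv N)%N -> coprime N k.
Proof.
case/andP=> k_gt0 ltkp; rewrite /coprime eqn_leq gcdn_gt0 k_gt0 orbT andbT.
rewrite leqNgt; apply/negP=> g_gt1.
have := pdiv_min_dvd g_gt1 (dvdn_gcdl N k).
by rewrite leqNgt (leq_ltn_trans (dvdn_leq k_gt0 (dvdn_gcdr N k)) ltkp).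
Qed.

(** A common divisor d > 1 of N and p + 1 would be at least p, hence equal to
    p + 1, which is even; then N would be even and p = 2. *)
Lemma coprime_pdivS (N : nat) :
  (1 < N)%N -> odd (pdiv N) -> coprime N (pdiv N).+1.
Proof.
move=> N_gt1 p_odd; have := prime_gt1 (pdiv_prime N_gt1).
set p := pdiv N in p_odd * => p_gt1.
rewrite /coprime eqn_leq gcdn_gt0 orbT andbT leqNgt; apply/negP=> g_gt1.
have le_pg := pdiv_min_dvd g_gt1 (dvdn_gcdl N p.+1).
have p_neq2 : p != 2 by apply/eqP => p2; rewrite p2 in p_odd.
have /dvdnP[q def_q] := dvdn_gcdr N p.+1.
have g_dvdN := dvdn_gcdl N p.+1.
rewrite -/p in le_pg.
(* A divisor of p + 1 that is at least p > 1 is p + 1 itself. *)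
have g_eq : gcdn N p.+1 = p.+1.
  have q1 : q = 1%N by nia.
  by rewrite [RHS]def_q q1 mul1n.
have g2 : (2 %| N)%N.
  by apply: dvdn_trans g_dvdN; rewrite g_eq dvdn2 /= p_odd.
have := pdiv_min_dvd (isT : (1 < 2)%N) g2; lia.
Qed.

(** * Row N - 1 and the rows above it modulo N *)

(** Here and below, working in a ring where N = 0 is computing modulo N;
    this covers the field 'F_N and the ring 'Z_N alike. *)
Lemma bin_pred_natr (R : comNzRingType) (N k : nat) :
  N%:R = 0 :> R -> (k < pdiv N)%N -> 'C(N.-1, k)%:R = (-1) ^+ k :> R.
Proof.
move=> N0; elim: k => [|k IHk] ltkp; first by rewrite bin0.
have N_gt0 : (0 < N)%N by case: (N) ltkp.
have /dvdnP[q Eq] : (N %| 'C(N, k.+1))%N.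
  by apply: coprime_dvdn_bin => //; apply: coprime_lt_pdiv.
have : ('C(N.-1.+1, k.+1))%:R = 0 :> R by rewrite prednK // Eq natrM N0 mulr0.
rewrite binS natrD IHk ?(ltnW ltkp) // => /eqP.
by rewrite addr_eq0 => /eqP ->; rewrite exprS mulN1r.
Qed.

(** The sign alternation fails at the least prime factor p of N, because
    'C(N, p) = (N / p) * 'C(N-1, p-1) no longer vanishes modulo N. *)
Lemma bin_pred_pdiv_natr (R : comNzRingType) (N : nat) :
  N%:R = 0 :> R -> (1 < N)%N ->
  'C(N.-1, pdiv N)%:R = (-1) ^+ pdiv N * (1 - (N %/ pdiv N)%:R) :> R.
Proof.
move=> N0 N_gt1; set m := (N %/ pdiv N)%N.
have EN : N = (m * pdiv N)%N by rewrite divnK ?pdiv_dvd.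
have [k Ep] : exists k, pdiv N = k.+1.
  by exists (pdiv N).-1; rewrite prednK ?pdiv_gt0.
have binN : ('C(N, k.+1) = m * 'C(N.-1, k))%N.
  apply/eqP; rewrite -(eqn_pmul2l (ltn0Sn k)) -mul_bin_diag.
  by rewrite mulnA [(k.+1 * m)%N]mulnC -Ep -EN.
have bin_k : 'C(N.-1, k)%:R = (-1) ^+ k :> R.
  by apply: bin_pred_natr; rewrite ?Ep.
have := congr1 (fun x => x%:R : R) binN.
rewrite -{1}(prednK (ltnW N_gt1)) binS natrD natrM bin_k Ep exprS => E.
by apply: (addIr ((-1) ^+ k)); rewrite E; ring.
Qed.

(** One step further N divides 'C(N, p + 1) again, so the defect N / p persists
    with the opposite sign; this is what refutes the pattern of W, whose zeros
    are at even i + j. *)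
Lemma bin_pred_pdivS_natr (R : comNzRingType) (N : nat) :
  N%:R = 0 :> R -> (1 < N)%N -> odd (pdiv N) ->
  'C(N.-1, (pdiv N).+1)%:R = 1 - (N %/ pdiv N)%:R :> R.
Proof.
move=> N0 N_gt1 p_odd.
have /dvdnP[q Eq] : (N %| 'C(N, (pdiv N).+1))%N.
  by apply: coprime_dvdn_bin => //; apply: coprime_pdivS.
have : ('C(N.-1.+1, (pdiv N).+1))%:R = 0 :> R.
  by rewrite prednK ?Eq ?natrM ?N0 ?mulr0 // ltnW.
rewrite binS natrD bin_pred_pdiv_natr // -signr_odd p_odd expr1 => E.
by apply: (addIr (-1 * (1 - (N %/ pdiv N)%:R))); rewrite E; ring.
Qed.

(** Column j + 1 follows from column j: both sides satisfy Pascal's rule, the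
    left one backwards, which is what turns the sign. *)
Lemma bin_reflect_natr (R : comNzRingType) (N j d : nat) :
  N%:R = 0 :> R -> (j + d < pdiv N)%N ->
  'C(N.-1 - j, d)%:R = (-1) ^+ d * 'C(j + d, d)%:R :> R.
Proof.
move=> N0; elim: j d => [|j IHj] d.
  by move=> ltd; rewrite subn0 add0n binn mulr1 bin_pred_natr.
elim: d => [|d IHd] ltp; first by rewrite !bin0 expr0 mulr1.
have N_gt0 : (0 < N)%N by case: (N) ltp.
have leqpN := pdiv_leq N_gt0.
have lt_jd : (j + d.+1 < pdiv N)%N by lia.
have := IHj d.+1 lt_jd.
have ENj : (N.-1 - j = (N.-1 - j.+1).+1)%N by lia.
rewrite ENj binS natrD IHd; last by lia.
rewrite -addSnnS [(j.+1 + d.+1)%N]addnS binS natrD exprS => E.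
apply: (addIr ((-1) ^+ d * 'C(j.+1 + d, d)%:R)); rewrite E; ring.
Qed.

(** * Prime N: the checkerboard of zeros *)

Lemma prime_ndvd_bin (p i j : nat) :
  prime p -> (j <= i < p)%N -> ~~ (p %| 'C(i, j))%N.
Proof.
move=> p_pr /andP[leji ltip].
have : ~~ (p %| i`!)%N.
  elim: i ltip {leji} => [|i IHi] ltip; first by rewrite dvdn1 neq_ltn prime_gt1 ?orbT.
  by rewrite factS Euclid_dvdM // negb_or IHi ?(ltnW ltip) // gtnNdvd.
by apply: contra => pC; rewrite -(bin_fact leji) dvdn_mulr.
Qed.

Lemma Dle_bin_sub (N i j : nat) :
  Dle N i j -> 'C(N - 1 - j, N - 1 - i) = 'C(N.-1 - j, i - j).
Proof.
move=> /andP[leji leiN]; rewrite subn1 -(bin_sub (n := N.-1 - j)); last by lia.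
by congr 'C(_, _); lia.
Qed.

(** Modulo N, S and W are (1 + e) 'C(i, j) and (1 - e) 'C(i, j) with
    e = (-1)^(i+j), and neither 2 nor 'C(i, j) vanishes in the field 'F_N. *)
Lemma prime_dvd_SbinWbin (N i j : nat) :
  prime N -> (2 < N)%N -> Dle N i j ->
  (N%:Z %| Sbin N i j)%Z = odd (i + j) /\
  (N%:Z %| Wbin N i j)%Z = ~~ odd (i + j).
Proof.
move=> N_pr N_gt2 D; have /andP[leji leiN] := D.
have ltiN : (i < N)%N by lia.
have charN := pchar_Fp N_pr.
have N0 := pchar_Fp_0 N_pr.
have Cn0 : ('C(i, j)%:R == 0 :> 'F_N) = false.
  by rewrite -(dvdn_pcharf charN); apply/negbTE/prime_ndvd_bin; rewrite ?leji.
have n2 : ((2%:R : 'F_N) == 0) = false by rewrite -(dvdn_pcharf charN) gtnNdvd.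
have E : 'C(N - 1 - j, N - 1 - i)%:R = (-1) ^+ (i + j) * 'C(i, j)%:R :> 'F_N.
  rewrite Dle_bin_sub // bin_reflect_natr //; last by rewrite pdiv_id ?subnKC.
  rewrite subnKC // bin_sub //.
  by rewrite -[in LHS]signr_odd -[in RHS]signr_odd oddB // oddD.
rewrite !(dvdz_pcharf charN) /Sbin /Wbin rmorphB rmorphD /= -!pmulrn E.
rewrite -signr_odd; case: odd; rewrite ?expr0 ?expr1 ?mulN1r ?mul1r ?opprK.
  by rewrite addrN eqxx -mulr2n -mulr_natr mulf_eq0 Cn0 n2.
by rewrite addrN eqxx -mulr2n -mulr_natr mulf_eq0 Cn0 n2.
Qed.

(** * Composite N: entries that break the checkerboard *)

Lemma eqr_nat_Zp (N a b : nat) :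
  (1 < N)%N -> (a%:R == b%:R :> 'Z_N) = (a == b %[mod N])%N.
Proof. by move=> N_gt1; rewrite -val_eqE /= !val_Zp_nat. Qed.

Lemma natr_Zp_eq0 (N n : nat) :
  (1 < N)%N -> (n%:R == 0 :> 'Z_N) = (N %| n)%N.
Proof. by move=> N_gt1; rewrite (eqr_nat_Zp n 0 N_gt1) mod0n. Qed.

Lemma dvdz_Zp (N : nat) (x : int) :
  (1 < N)%N -> (N%:Z %| x)%Z = (x%:~R == 0 :> 'Z_N).
Proof.
move=> N_gt1; case: x => n; rewrite ?NegzE ?mulrNz ?oppr_eq0 -?pmulrn.
  by rewrite natr_Zp_eq0 // dvdzE.
by rewrite natr_Zp_eq0 // dvdzE abszN.
Qed.

Lemma Sbin_col0 (R : pzRingType) (N k : nat) :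
  (k < N)%N -> (Sbin N k 0)%:~R = 1 + 'C(N.-1, k)%:R :> R.
Proof.
move=> ltkN; rewrite /Sbin Dle_bin_sub ?/Dle /=; last by lia.
by rewrite !subn0 bin0 rmorphD /= -!pmulrn.
Qed.

Lemma Wbin_col0 (R : pzRingType) (N k : nat) :
  (k < N)%N -> (Wbin N k 0)%:~R = 1 - 'C(N.-1, k)%:R :> R.
Proof.
move=> ltkN; rewrite /Wbin Dle_bin_sub ?/Dle /=; last by lia.
by rewrite !subn0 bin0 rmorphB /= -!pmulrn.
Qed.

Lemma pdiv_leq_cofactor (N : nat) :
  (2 < N)%N -> ~~ prime N -> (pdiv N <= N %/ pdiv N)%N.
Proof.
move=> N_gt2 /negP N_comp; rewrite leqNgt; apply/negP => ltmp.
apply: N_comp; apply: ltn_pdiv2_prime; first by lia.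
by rewrite -{1}(divnK (pdiv_dvd N)) expnSr expn1 ltn_pmul2r ?pdiv_gt0.
Qed.

(** The witness is (p, 0), where S = N / p, if p is odd, and (N - 1, 0), where
    S = 2, if N is even. *)
Lemma composite_Sbin_odd (N : nat) : (2 < N)%N -> ~~ prime N ->
  exists i j, [/\ Dle N i j, odd (i + j) & ~~ (N%:Z %| Sbin N i j)%Z].
Proof.
move=> N_gt2 N_comp; have N_gt1 := ltnW N_gt2; have N_gt0 := ltnW N_gt1.
have p_gt1 := prime_gt1 (pdiv_prime N_gt1).
have le_pm := pdiv_leq_cofactor N_gt2 N_comp.
have EN := divnK (pdiv_dvd N).
case p_odd: (odd (pdiv N)).
  exists (pdiv N), 0%N; rewrite addn0 p_odd /Dle /=; split=> //; first by nia.
  rewrite dvdz_Zp // Sbin_col0; last by nia.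
  rewrite bin_pred_pdiv_natr ?pchar_Zp // -signr_odd p_odd expr1 mulN1r.
  by rewrite subKr natr_Zp_eq0 // gtnNdvd; nia.
have N_even : odd N = false by rewrite -EN oddM p_odd andbF.
exists N.-1, 0%N; rewrite addn0 /Dle /=; split; [by lia| by lia|].
rewrite dvdz_Zp // Sbin_col0 ?prednK // binn -(natrD _ 1 1) natr_Zp_eq0 //.
by rewrite gtnNdvd.
Qed.

(** The witness is (k, 0) with k the even number among p and p + 1; there
    W = N / p. *)
Lemma composite_Wbin_even (N : nat) : (2 < N)%N -> ~~ prime N ->
  exists i j, [/\ Dle N i j, ~~ odd (i + j) & ~~ (N%:Z %| Wbin N i j)%Z].
Proof.
move=> N_gt2 N_comp; have N_gt1 := ltnW N_gt2.
have p_gt1 := prime_gt1 (pdiv_prime N_gt1).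
have le_pm := pdiv_leq_cofactor N_gt2 N_comp.
have EN := divnK (pdiv_dvd N).
have m_neq0 : (N %/ pdiv N)%:R != 0 :> 'Z_N.
  by rewrite natr_Zp_eq0 // gtnNdvd; nia.
case p_odd: (odd (pdiv N)).
  have p_neq2 : pdiv N != 2 by apply/eqP => p2; rewrite p2 in p_odd.
  exists (pdiv N).+1, 0%N; rewrite addn0 /= p_odd /Dle /=; split=> //; first by nia.
  rewrite dvdz_Zp // Wbin_col0; last by nia.
  by rewrite bin_pred_pdivS_natr ?pchar_Zp // subKr.
exists (pdiv N), 0%N; rewrite addn0 p_odd /Dle /=; split=> //; first by nia.
rewrite dvdz_Zp // Wbin_col0; last by nia.
by rewrite bin_pred_pdiv_natr ?pchar_Zp // -signr_odd p_odd mul1r subKr.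
Qed.

(** At (p, 0) the values of S and W are N / p and 2 - N / p in some order, both
    nonzero modulo N since 2 < N / p < N except for N = 4. *)
Lemma composite_SbinWbin (N : nat) : (2 < N)%N -> ~~ prime N ->
  exists i j, Dle N i j /\ (N%:Z %| Sbin N i j)%Z = (N%:Z %| Wbin N i j)%Z.
Proof.
move=> N_gt2 N_comp; have N_gt1 := ltnW N_gt2.
(* For N = 4 the cofactor of p = 2 is 2, so 2 - m vanishes and the entry
   (p, 0) does not help; at (2, 1) one has S = 4 and W = 0. *)
have [-> | N_neq4] := eqVneq N 4%N; first by exists 2%N, 1%N.
have p_gt1 := prime_gt1 (pdiv_prime N_gt1).
have le_pm := pdiv_leq_cofactor N_gt2 N_comp.
have EN := divnK (pdiv_dvd N).
have m_neq0 : (N %/ pdiv N)%:R != 0 :> 'Z_N.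
  by rewrite natr_Zp_eq0 // gtnNdvd; nia.
have m_neq2 : 2%:R - (N %/ pdiv N)%:R != 0 :> 'Z_N.
  rewrite subr_eq0 (eqr_nat_Zp 2) // !modn_small //; last by nia.
  by apply/eqP=> m2; move/eqP: N_neq4; apply; nia.
exists (pdiv N), 0%N; rewrite /Dle /=; split; first by nia.
rewrite !dvdz_Zp // Sbin_col0 ?Wbin_col0; [|by nia|by nia].
rewrite bin_pred_pdiv_natr ?pchar_Zp // -signr_odd.
have E (x : 'Z_N) : 1 + (1 - x) = 2%:R - x by rewrite addrA -(natrD _ 1 1).
case: odd; rewrite ?expr0 ?expr1 ?mulN1r ?mul1r ?opprK subKr E.
  by rewrite (negbTE m_neq0) (negbTE m_neq2).
by rewrite (negbTE m_neq0) (negbTE m_neq2).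
Qed.

(** * The equivalence *)

Lemma ind_nondvdE (N : nat) (x : int) :
  ind_nondvd N x = (~~ (N%:Z %| x)%Z)%:R.
Proof. by rewrite /ind_nondvd; case: ifP. Qed.

Lemma half_1Dsign (n : nat) : (1 + (-1) ^+ n) / 2 = (~~ odd n)%:R :> rat.
Proof. by rewrite -signr_odd; case: odd. Qed.

Lemma half_1Bsign (n : nat) : (1 - (-1) ^+ n) / 2 = (odd n)%:R :> rat.
Proof. by rewrite -signr_odd; case: odd. Qed.

Lemma norm_boolB (a b : bool) : (`|a%:R - b%:R : rat| == 1) = (a != b).
Proof. by case: a; case: b. Qed.

Theorem theorem2p3 (N : nat) (hN : (2 < N)%N) :
  [<-> prime N;
       forall i j : nat, Dle N i j ->
         ind_nondvd N (Sbin N i j) = (1 + (-1) ^+ (i + j)) / 2;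
       forall i j : nat, Dle N i j ->
         ind_nondvd N (Wbin N i j) = (1 - (-1) ^+ (i + j)) / 2;
       forall i j : nat, Dle N i j ->
         `|ind_nondvd N (Sbin N i j) - ind_nondvd N (Wbin N i j)| = 1].
Proof.
have S_prime : (forall i j, Dle N i j ->
    ind_nondvd N (Sbin N i j) = (1 + (-1) ^+ (i + j)) / 2) -> prime N.
  move=> S_ind; apply/negPn/negP => N_comp.
  have [i [j [D ij_odd ndvd]]] := composite_Sbin_odd hN N_comp.
  by have /eqP := S_ind i j D; rewrite ind_nondvdE half_1Dsign ndvd ij_odd.
have W_prime : (forall i j, Dle N i j ->
    ind_nondvd N (Wbin N i j) = (1 - (-1) ^+ (i + j)) / 2) -> prime N.
  move=> W_ind; apply/negPn/negP => N_comp.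
  have [i [j [D ij_even ndvd]]] := composite_Wbin_even hN N_comp.
  have /eqP := W_ind i j D.
  by rewrite ind_nondvdE half_1Bsign ndvd (negbTE ij_even).
tfae=> [N_pr i j D | /S_prime N_pr i j D | /W_prime N_pr i j D | SW_ind].
- by rewrite ind_nondvdE half_1Dsign; have [-> _] := prime_dvd_SbinWbin N_pr hN D.
- rewrite ind_nondvdE half_1Bsign; have [_ ->] := prime_dvd_SbinWbin N_pr hN D.
  by rewrite negbK.
- apply/eqP; rewrite !ind_nondvdE norm_boolB.
  by have [-> ->] := prime_dvd_SbinWbin N_pr hN D; case: odd.
apply/negPn/negP => N_comp.
have [i [j [D eqSW]]] := composite_SbinWbin hN N_comp.
by have /eqP := SW_ind i j D; rewrite !ind_nondvdE norm_boolB eqSW eqxx.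
Qed.
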